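(* Let $G$ be a sofic group and let $N \leq G$ be a locally finite subgroup of $G$. Then the left multiplication action $\alpha: G \curvearrowright G/N$ is sofic.
   Context: For a nonempty finite set $A$, $\mathrm{Sym}(A)$ is the group of permutations of $A$, with the normalized Hamming distance $d(\sigma,\tau) = |\{a \in A : \sigma(a) \neq \tau(a)\}|/|A|$. Let $\Gamma$ be a countable discrete group, $A$ a finite set, and $\varphi: \Gamma \to \mathrm{Sym}(A)$ a map (not necessarily a homomorphism). $\varphi$ is unital if $\varphi(1_\Gamma) = 1$. For finite $F \subseteq \Gamma$ and $\epsilon > 0$, $\varphi$ is $(F,\epsilon)$-multiplicative if $d(\varphi(gh), \varphi(g)\varphi(h)) < \epsilon$ for all $g,h \in F$. A countable discrete group $\Gamma$ is sofic if for all finite $F \subseteq \Gamma$ and $\epsilon > 0$ there exist a finite set $A$ and a map $\varphi: \Gamma \to \mathrm{Sym}(A)$ which is unital, $(F,\epsilon)$-multiplicative, and satisfies $d(1,\varphi(g)) > 1-\epsilon$ for all $g \in F \setminus \{1_\Gamma\}$. Let $\alpha: \Gamma \curvearrowright X$ be an action of a countable discrete group on a countable discrete set. For finite $F \subseteq \Gamma$, finite $E \subseteq X$ and $\epsilon > 0$, a map $\varphi: \Gamma \to \mathrm{Sym}(A)$ is an $(F,E,\epsilon)$-orbit approximation of $\alpha$ if there exist a finite set $B$ and a subset $S \subseteq A$ with $|S| > (1-\epsilon)|A|$ and, for each $s \in S$, an injective map $\pi_s: E \hookrightarrow B$, such that $\pi_{\varphi(g)s}(x) = \pi_s(\alpha(g^{-1})x)$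 for all $s \in S$, $g \in F$, $x \in E$ whenever $\varphi(g)s \in S$ and $\alpha(g^{-1})x \in E$. The action $\alpha$ is sofic if for all finite $F \subseteq \Gamma$, finite $E \subseteq X$ and $\epsilon > 0$ there exist a finite set $A$ and a map $\varphi: \Gamma \to \mathrm{Sym}(A)$ which is unital, $(F,\epsilon)$-multiplicative, and an $(F,E,\epsilon)$-orbit approximation of $\alpha$. A group is locally finite if each of its finitely generated subgroups is finite. $G/N$ denotes the set of left cosets ($N$ is not assumed normal), and the left multiplication action is $\alpha(g)(kN) = gkN$. *)

(* Defs.v *)
From HB Require Import structures.
From mathcomp Require Import all_boot all_order all_algebra all_fingroup.
From mathcomp Require Import all_classical all_reals.

Set Implicit Arguments.
Unset Strict Implicit.
Unset Printing Implicit Defensive.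

Import Order.TTheory GRing.Theory Num.Theory.

Local Open Scope classical_set_scope.
Local Open Scope ring_scope.

Definition hamming (R : realType) (A : finType) (s t : {perm A}) : R :=
  #|[pred a | s a != t a]|%:R / #|A|%:R.

Section Approximations.
Variables (G : groupType) (A : finType) (phi : G -> {perm A}).

Definition unital : Prop := phi 1%g = 1%g.

(* MathComp composes permutations from left to right, [(s * t)%g a = t (s a)],
   so the composite a |-> phi g (phi h a) is [(phi h * phi g)%g]. *)
Definition multiplicative_on (R : realType) (F : set G) (eps : R) : Prop :=
  forall g h, F g -> F h ->
    hamming R (phi (g * h)%g) (phi h * phi g)%g < eps.

End Approximations.

Definition sofic_group (R : realType) (G : groupType) : Prop :=
  forall (F : set G) (eps : R), finite_set F -> 0 < eps ->
  exists (A : finType) (phi : G -> {perm A}),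
    [/\ (0 < #|A|)%N, unital phi, multiplicative_on phi F eps &
        forall g, F g -> g <> 1%g -> 1 - eps < hamming R 1%g (phi g)].

Record left_action (G : groupType) (X : Type) := LeftAction {
  lact :> G -> X -> X;
  lact1 : forall x, lact 1%g x = x;
  lactM : forall g h x, lact (g * h)%g x = lact g (lact h x)
}.

(* The injections E -> B are represented by total functions X -> B of which
   only the values on E matter, and similarly only the indices s in S matter;
   as B is existentially quantified (and may be enlarged by a point), this is no
   restriction. *)
Definition orbit_approximation (R : realType) (G : groupType) (X : Type)
    (alpha : left_action G X) (F : set G) (E : set X) (eps : R)
    (A : finType) (phi : G -> {perm A}) : Prop :=
  exists (B : finType) (S : {set A}) (p : A -> X -> B),
    [/\ (1 - eps) * #|A|%:R < #|S|%:R,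
        forall s, s \in S -> set_inj E (p s) &
        forall s g x, s \in S -> F g -> E x ->
          phi g s \in S -> E (alpha g^-1%g x) ->
          p (phi g s) x = p s (alpha g^-1%g x)].

Definition sofic_action (R : realType) (G : groupType) (X : Type)
    (alpha : left_action G X) : Prop :=
  forall (F : set G) (E : set X) (eps : R),
    finite_set F -> finite_set E -> 0 < eps ->
  exists (A : finType) (phi : G -> {perm A}),
    [/\ (0 < #|A|)%N, unital phi, multiplicative_on phi F eps &
        orbit_approximation alpha F E eps phi].

Definition is_subgroup (G : groupType) (H : set G) : Prop :=
  group_closed (mem H).

Definition finitely_generated (G : groupType) (H : set G) : Prop :=
  exists2 S : set G, finite_set S & H = smallest (@is_subgroup G) S.

Definition locally_finite (G : groupType) (N : set G) : Prop :=
  forall H : set G, is_subgroup H -> H `<=` N ->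
    finitely_generated H -> finite_set H.

Section LeftCosets.
Variables (G : groupType) (N : set G).

Definition left_coset (k : G) : set G := [set (k * n)%g | n in N].

(* The set G / N, usable as a type through the coercion [set_type]. *)
Definition left_cosets : set (set G) := range left_coset.

Lemma image_left_coset (g k : G) :
  [set (g * x)%g | x in left_coset k] = left_coset (g * k)%g.
Proof.
apply/seteqP; split => x /=.
  by move=> [_ [n Nn <-] <-]; exists n => //; rewrite mulgA.
by move=> [n Nn <-]; exists (k * n)%g; [exists n | rewrite mulgA].
Qed.

Lemma left_cosets_mul (g : G) (C : left_cosets) :
  [set (g * x)%g | x in val C] \in left_cosets.
Proof.
case: C => C /= /set_mem[k _ <-]; apply/mem_set.
by exists (g * k)%g => //; rewrite image_left_coset.
Qed.

Definition left_coset_mul (g : G) (C : left_cosets) : left_cosets :=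
  exist (fun D => D \in left_cosets) _ (left_cosets_mul g C).

Lemma left_coset_mul1 (C : left_cosets) : left_coset_mul 1%g C = C.
Proof.
apply: val_inj => /=; apply/seteqP; split => x /=.
  by move=> [y Cy <-]; rewrite mul1g.
by move=> Cx; exists x; rewrite ?mul1g.
Qed.

Lemma left_coset_mulM (g h : G) (C : left_cosets) :
  left_coset_mul (g * h)%g C = left_coset_mul g (left_coset_mul h C).
Proof.
apply: val_inj => /=; apply/seteqP; split => x /=.
  by move=> [y Cy <-]; exists (h * y)%g; [exists y | rewrite mulgA].
by move=> [_ [y Cy <-] <-]; exists y; rewrite ?mulgA.
Qed.

Definition left_coset_action : left_action G left_cosets :=
  LeftAction left_coset_mul1 left_coset_mulM.

End LeftCosets.

(* Main.v *)
(* A point [s] of a sufficiently good sofic approximation [phi] of [G] behaves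
   like a point of a free action on the finite window of [G] that matters.
   Choose coset representatives [r x] for [x] in [E]; the elements
   [(r y)^-1 g^-1 (r x)] lying in [N], with [g] in [F] and [x], [y] in [E],
   generate a finite subgroup [K]. Then
     pi_s(x) = {phi(k (r x)^-1) s | k in K},
   with values in the subsets of [A], is injective in [x] because [phi] is
   almost free, and it is equivariant because [y = g^-1 x] gives
   [K (r x)^-1 g = K (r y)^-1]. *)
Require Import Defs.
From mathcomp Require Import all_boot all_order all_algebra all_fingroup.
From mathcomp Require Import all_classical all_reals.

Local Open Scope classical_set_scope.

Import Order.TTheory GRing.Theory Num.Theory.

Lemma card_bigcup_seq_le (R : realType) (A : finType) (c : R)
    (l : seq {set A}) :
  (forall B, B \in l -> #|B|%:R <= c)%R ->
  (#|(\bigcup_(B <- l) B)%SET|%:R <= (size l)%:R * c)%R.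
Proof.
elim: l => [|B l IHl] le_c; first by rewrite big_nil cards0 mul0r.
rewrite big_cons /= -natr1 mulrDl mul1r addrC.
have leU : (#|B :|: \bigcup_(C <- l) C|%SET <=
            #|B| + #|(\bigcup_(C <- l) C)%SET|)%N.
  by rewrite cardsU leq_subr.
apply: (le_trans (y := (#|B| + #|(\bigcup_(C <- l) C)%SET|)%:R%R)).
  by rewrite ler_nat.
rewrite natrD; apply: lerD; first by apply: le_c; rewrite mem_head.
by apply: IHl => C lC; apply: le_c; rewrite inE lC orbT.
Qed.

Lemma card_agree (R : realType) (A : finType) (s t : {perm A}) : (0 < #|A|)%N ->
  (#|[set a | s a == t a]%SET|%:R = (1 - hamming R s t) * #|A|%:R)%R.
Proof.
move=> A0; have nA : (#|A|%:R != 0 :> R)%R by rewrite pnatr_eq0 -lt0n.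
rewrite /hamming mulrBl mul1r divfK// -(cardsC [set a | s a == t a]%SET).
rewrite natrD (_ : #|[pred a | s a != t a]| = #|~: [set a | s a == t a]|%SET).
  by rewrite addrK.
by apply: eq_card => a; rewrite !inE.
Qed.

(** This turns soficity into exact identities at most points. Each failure of multiplicativity or of
    freeness on [F] occurs on a set of density at most [delta]; there are finitely many such sets,
    and [S] is the complement of their union. *)
Lemma sofic_group_generic_points {R : realType} {G : groupType} (F : set G)
    (eps : R) : sofic_group R G -> finite_set F -> (0 < eps)%R ->
  exists (A : finType) (phi : G -> {perm A}) (S : {set A}),
    [/\ [/\ (0 < #|A|)%N, unital phi & multiplicative_on phi F eps],
        ((1 - eps) * #|A|%:R < #|S|%:R)%R,
        forall s g h, s \in S -> F g -> F h ->
          phi (g * h)%g s = phi g (phi h s) &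
        forall s g, s \in S -> F g -> phi g s = s -> g = 1%g].
Proof.
move=> sofG finF eps0.
have [L FL] := (finite_seqP F).1 finF.
have memL g : F g <-> g \in L by rewrite FL.
(* [M] bounds the number of sets in [bad]: one per pair from [L], at most one per element. The
   successor in [delta] keeps the denominator positive when [L] is empty and makes [M * delta < eps]
   strict. *)
pose M := (size L * size L + size L)%N.
pose delta : R := (eps / M.+1%:R)%R.
have M0 : (0 < M.+1%:R :> R)%R by rewrite ltr0n.
have delta0 : (0 < delta)%R by rewrite divr_gt0.
have Mdelta : (M%:R * delta < eps)%R.
  by rewrite /delta mulrCA gtr_pMr// ltr_pdivrMr// mul1r ltr_nat.
have delta_le : (delta <= eps)%R.
  by rewrite /delta ler_pdivrMr// ler_peMr ?ler1n// ltW.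
have [A [phi [A0 phi1 phiM phiF]]] := sofG F delta finF delta0.
have A0R : (0 < #|A|%:R :> R)%R by rewrite ltr0n.
pose nonmul g h := [set a | phi (g * h)%g a != (phi h * phi g)%g a]%SET.
pose fixed g := [set a | (1 : {perm A})%g a == phi g a]%SET.
pose bad := [seq nonmul g h | g <- L, h <- L] ++
            [seq fixed g | g <- [seq g <- L | g != 1%g]].
have bad_small B : B \in bad -> (#|B|%:R <= delta * #|A|%:R)%R.
  rewrite mem_cat => /orP[/allpairsP[[g h] /= [Lg Lh ->]]|/mapP[g]].
    rewrite -ler_pdivrMr// ltW//; have := phiM g h _ _; rewrite /hamming.
    rewrite (_ : #|nonmul g h| = #|[pred a | phi (g * h)%g a !=
      (phi h * phi g)%g a]|); first by apply; apply/memL.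
    by apply: eq_card => a; rewrite !inE.
  rewrite mem_filter => /andP[/eqP g1 Lg] ->.
  (* [fixed g] is the agreement set of [1] and [phi g], whose density is one minus their Hamming
     distance. *)
  rewrite card_agree// ler_pM2r// ltW// ltrBlDl -ltrBlDr.
  by apply: phiF g1; apply/memL.
exists A, phi, (~: \bigcup_(B <- bad) B)%SET; split.
- split=> // g h Fg Fh; apply: lt_le_trans delta_le; exact: phiM.
- set U := (\bigcup_(B <- bad) B)%SET.
  have -> : (#|~: U|%SET%:R = #|A|%:R - #|U|%:R :> R)%R.
    by rewrite -(cardsC U) natrD addrC addKr.
  rewrite mulrBl mul1r ltrD2l ltrN2.
  apply: le_lt_trans (card_bigcup_seq_le _ _ _ bad bad_small) _.
  rewrite mulrA ltr_pM2r//; apply: le_lt_trans Mdelta.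
  rewrite ler_pM2r// ler_nat size_cat size_allpairs size_map size_filter.
  by rewrite leq_add2l count_size.
- move=> s g h; rewrite inE => /negP sS /memL Lg /memL Lh.
  apply/eqP; rewrite -[phi g _]permM; apply/negP => /negP neq; apply: sS.
  rewrite finset.bigcup_seq; apply/bigcupP; exists (nonmul g h); last by rewrite inE.
  by rewrite mem_cat; apply/orP; left; apply/allpairsP; exists (g, h).
- move=> s g; rewrite inE => /negP sS /memL Lg fixs.
  apply/eqP/negP => /negP g1; apply: sS.
  rewrite finset.bigcup_seq; apply/bigcupP; exists (fixed g).
    rewrite mem_cat; apply/orP; right; apply/mapP; exists g => //.
    by rewrite mem_filter g1.
  by rewrite inE perm1 fixs.
Qed.

Section Subgroups.
Context {G : groupType}.

Lemma is_subgroup1 {H : set G} : is_subgroup H -> H 1%g.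
Proof. by move=> [/set_mem]. Qed.

Lemma is_subgroup_div {H : set G} (a b : G) : is_subgroup H ->
  H a -> H b -> H (a * b^-1)%g.
Proof. by move=> [_ clH] /mem_set Ha /mem_set Hb; apply/set_mem/clH. Qed.

Lemma is_subgroupV {H : set G} (a : G) : is_subgroup H -> H a -> H a^-1%g.
Proof.
move=> sH Ha; rewrite -[a^-1%g]mul1g.
exact: is_subgroup_div sH (is_subgroup1 sH) Ha.
Qed.

Lemma is_subgroupM {H : set G} (a b : G) : is_subgroup H ->
  H a -> H b -> H (a * b)%g.
Proof.
move=> sH Ha Hb; rewrite -[b]invgK.
exact: is_subgroup_div sH Ha (is_subgroupV b sH Hb).
Qed.

Lemma is_subgroup_smallest (T : set G) : is_subgroup (smallest (@is_subgroup G) T).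
Proof.
split=> [|a b /set_mem Ka /set_mem Kb]; apply/mem_set.
  by move=> H [/is_subgroup1].
move=> H [sH TH]; apply: is_subgroup_div => //.
  exact: Ka.
exact: Kb.
Qed.

Lemma locally_finite_smallest (N T : set G) : is_subgroup N ->
  locally_finite N -> finite_set T -> T `<=` N ->
  finite_set (smallest (@is_subgroup G) T).
Proof.
move=> sN lfN finT TN; apply: lfN; first exact: is_subgroup_smallest.
  exact: smallest_sub.
by exists T.
Qed.

Lemma left_coset_eqP (N : set G) (a b : G) : is_subgroup N ->
  left_coset N a = left_coset N b <-> N (a^-1 * b)%g.
Proof.
move=> sN; split=> [ab|Nab].
  have : left_coset N b b by exists 1%g; rewrite ?mulg1//; exact: is_subgroup1.
  by rewrite -ab => -[n Nn <-]; rewrite mulKg.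
apply/seteqP; split=> x [n Nn <-].
  exists ((a^-1 * b)^-1 * n)%g; last by rewrite invMg invgK !mulgA mulgV mul1g.
  exact: is_subgroupM (is_subgroupV _ sN Nab) Nn.
exists (a^-1 * b * n)%g; last by rewrite !mulgA mulgV mul1g.
exact: is_subgroupM.
Qed.

End Subgroups.

Theorem theorem2p14 (R : realType) (G : groupType) (N : set G) :
  countable [set: G] -> sofic_group R G ->
  is_subgroup N -> locally_finite N ->
  sofic_action R (left_coset_action N).
Proof.
move=> _ sofG sN lfN F E eps finF finE eps0.
have /choice[r rE] (x : left_cosets N) : exists k, left_coset N k = val x.
  by case: x => C /= /set_mem[k _ <-]; exists k.
pose T := [set ((r y)^-1 * (gx.1^-1 * r gx.2))%g | y in E &
                gx in F `*` E] `&` N.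
pose K := smallest (@is_subgroup G) T.
have sK : is_subgroup K by exact: is_subgroup_smallest.
have KN : K `<=` N by apply: smallest_sub => // k [].
(* Local finiteness of [N] enters here. Finiteness of [K] makes [P] and [W] finite, so that soficity
   applies to [W]. *)
have finK : finite_set K.
  apply: locally_finite_smallest (lfN) _ _ => //.
    apply: finite_setIl; apply: finite_image2 => //; exact: finite_setX.
  by move=> k [].
pose P := [set (k * (r x)^-1)%g | k in K & x in E].
have finP : finite_set P by exact: finite_image2.
have PE k x : K k -> E x -> P (k * (r x)^-1)%g.
  by move=> Kk Ex; exists k => //; exists x.
(* [F] and [P] provide the products to be evaluated exactly at [s]; the quotients [b^-1 * a] let
   freeness separate the points [phi a s] for [a] in [P]. *)
pose W := F `|` P `|` [set (b^-1 * a)%g | b in P & a in P].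
have finW : finite_set W.
  by rewrite !finite_setU; split; [split|exact: finite_image2].
have FW : F `<=` W by move=> g Fg; left; left.
have PW : P `<=` W by move=> g Pg; left; right.
have [A [phi [S [[A0 phi1 phiM] cardS mulS freeS]]]] :=
  sofic_group_generic_points W eps sofG finW eps0.
have injS s a b : s \in S -> P a -> P b -> phi a s = phi b s -> a = b.
  move=> Ss Pa Pb ab; have Wba : W (b^-1 * a)%g by right; exists b => //; exists a.
  suff ba1 : (b^-1 * a = 1)%g by rewrite -[a](mulKVg b) ba1 mulg1.
  apply: (freeS s) => //; apply: (@perm_inj _ (phi b)).
  by rewrite -mulS ?mulKVg//; exact: PW.
exists A, phi; split=> //.
  by move=> g h /FW Wg /FW Wh; exact: phiM.
pose p s x := [set a | `[< exists2 k, K k & a = phi (k * (r x)^-1)%g s >]]%SET.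
exists {set A}, S, p; split=> //.
  (* The point of [p s x] with [k = 1] also lies in [p s y], so [injS] gives
     [(r x)^-1 = k * (r y)^-1] with [k] in [K], hence in [N]: the two cosets agree. *)
  move=> s Ss x y /set_mem Ex /set_mem Ey pxy.
  have : phi (1 * (r x)^-1)%g s \in p s x.
    by rewrite inE; apply/asboolP; exists 1%g => //; exact: is_subgroup1.
  rewrite pxy inE => /asboolP[k Kk] /injS eq_k.
  have {eq_k} : (1 * (r x)^-1 = k * (r y)^-1)%g.
    by apply: eq_k => //; apply: PE => //; exact: is_subgroup1.
  rewrite mul1g => rx; apply: val_inj; rewrite -!rE; apply/left_coset_eqP => //.
  by rewrite rx mulgVK; exact: KN.
move=> s g x Ss Fg Ex Sgs /=; set y := left_coset_mul _ _ => Ey.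
pose n := ((r y)^-1 * (g^-1 * r x))%g.
(* Since [y] is the coset of both [r y] and [g^-1 * r x], the quotient [n] lies in [N], hence in
   [T]. *)
have Kn : K n.
  apply: sub_gen_smallest; split; first by exists y => //; exists (g, x).
  by apply/left_coset_eqP => //; rewrite -image_left_coset !rE.
(* Right translation by [n^-1] permutes [K], so this identity reindexes [p (phi g s) x] as
   [p s y]. *)
have rxg k : (k * (r x)^-1 * g = k * n^-1 * (r y)^-1)%g.
  by rewrite /n !invMg !invgK !mulgA mulgK.
apply/setP => a; rewrite !inE; apply/asboolP/asboolP => -[k Kk ->].
  exists (k * n^-1)%g; first exact: is_subgroup_div sK Kk Kn.
  by rewrite -rxg [RHS]mulS//; [apply: PW; exact: PE|exact: FW].
exists (k * n)%g; first exact: is_subgroupM sK Kk Kn.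
rewrite -[RHS]mulS//; last exact: FW; last by apply: PW; apply: PE => //; exact: is_subgroupM sK Kk Kn.
by rewrite rxg mulgK.
Qed.
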